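(* For all nonnegative integers $n$, $m$, $k$, the following three sets are in bijection: (1) the set of oscillating tableaux of length $n$, with height bounded by $k$, starting from $\emptyset$ and ending in the one-row shape $(m)$; (2) the set of $W_k$-oscillating lattice walks of length $n$ starting at $\delta=(k,k-1,\dots,1)$ and ending at $(m+k,k-1,\dots,1)$; (3) the set of open matching diagrams on $n$ vertices with exactly $m$ open arcs that contain neither a $(k+1)$-nesting nor a future $(k+1)$-nesting.
   Context: Ferrers diagrams are identified with integer partitions; $(0)$ denotes the empty shape. An oscillating tableau of length $n$ is a sequence of Ferrers diagrams $\emptyset=\lambda^0,\lambda^1,\dots,\lambda^n$ in which each $\lambda^{i+1}$ is obtained from $\lambda^i$ by adding one box or deleting one box; it has height bounded by $k$ if no diagram in the sequence has more than $k$ rows. Let $W_k=\{(x_1,\dots,x_k)\in\mathbb{Z}^k: x_1>x_2>\dots>x_k>0\}$ and let $e_i$ be the $i$-th standard unit vector. A $W_k$-oscillating walk of length $n$ is a sequence of $n$ steps, each of the form $e_i$ or $-e_i$ ($1\le i\le k$), all of whose visited points lie in $W_k$. An open matching diagram on $n$ vertices consists of vertices $1,\dots,n$ on a line, closed arcs $(i,j)$ with $1\le i<j\le n$, and open arcs (each having a left endpoint in $\{1,\dots,n\}$ and no right endpoint), such that every vertex is an endpoint of exactly one arc. Closed arcs $(i_1,j_1),\dots,(i_r,j_r)$ form an $r$-nesting if $i_1<i_2<\dots<i_r<j_r<\dots<j_2<j_1$. A future $(k+1)$-nesting is an open arc with left endpoint $a$ together with a $k$-nesting $(i_1,j_1),\dots,(i_k,j_k)$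 of closed arcs with $a<i_1$. *)

(* Defs.v *)
From HB Require Import structures.
From mathcomp Require Import all_boot all_order all_algebra.

Set Implicit Arguments.
Unset Strict Implicit.
Unset Printing Implicit Defensive.

Import Order.TTheory GRing.Theory Num.Theory.

Local Open Scope ring_scope.

(** * Oscillating tableaux *)

(* Ferrers diagrams are the weakly decreasing sequences of positive row
   lengths, so that [size] is the number of rows and [::] the empty shape. *)
Definition is_shape (la : seq nat) : bool := sorted geq la && (0%N \notin la).

(* [mu] is [la] with one more box, at the end of a row of [la] or as a new row;
   used only between shapes. *)
Definition adds_box (la mu : seq nat) : bool :=
  [exists i : 'I_(size la).+1, mu == incr_nth la i].

(* The one-row shape (m), with (0) the empty shape. *)
Definition one_row (m : nat) : seq nat := if m == 0%N then [::] else [:: m].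

Definition is_oscillating_tableau (n k m : nat) (t : n.+1.-tuple (seq nat)) :
    bool :=
  [&& all is_shape t,
      sorted (fun la mu => adds_box la mu || adds_box mu la) t,
      all (fun la => (size la <= k)%N) t,
      tnth t ord0 == [::]
    & tnth t ord_max == one_row m].

Definition oscillating_tableau (n k m : nat) : Type :=
  {t : n.+1.-tuple (seq nat) | is_oscillating_tableau k m t}.

(** * Oscillating walks in the Weyl chamber *)

Definition in_chamber (k : nat) (x : 'rV[int]_k) : bool :=
  [forall i : 'I_k, forall j : 'I_k, (i < j)%N ==> (x 0 j < x 0 i)] &&
  [forall i : 'I_k, 0 < x 0 i].

Definition is_step (k : nat) (v : 'rV[int]_k) : bool :=
  [exists i : 'I_k, (v == delta_mx 0 i) || (v == - delta_mx 0 i)].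

Definition wstart (k : nat) : 'rV[int]_k := \row_(i < k) (k - i)%N%:Z.

(* [x] is the point (m + k, k - 1, ..., 1).  When k = 0 there is no first
   coordinate to carry m: the point then exists only for m = 0, where it is the
   starting point, the unique point of Z^0. *)
Definition is_wend (k m : nat) (x : 'rV[int]_k) : bool :=
  ((0 < k)%N || (m == 0%N)) &&
  (x == \row_(i < k) (if i == 0%N :> nat then (m + k)%N else (k - i)%N)%:Z).

(* [scanl +%R x w] lists the points visited from [x] after each step of [w]. *)
Definition is_oscillating_walk (n k m : nat) (w : n.-tuple 'rV[int]_k) : bool :=
  let visited := wstart k :: scanl +%R (wstart k) w in
  [&& all (@is_step k) w,
      all (@in_chamber k) visited
    & is_wend m (last (wstart k) visited)].

Definition oscillating_walk (n k m : nat) : Type :=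
  {w : n.-tuple 'rV[int]_k | is_oscillating_walk m w}.

(** * Open matching diagrams *)

(* A pair (closed arcs, left endpoints of the open arcs); the vertices
   1, ..., n are represented by the elements 0, ..., n - 1 of 'I_n. *)
Definition diagram (n : nat) : Type :=
  ({set 'I_n * 'I_n} * {set 'I_n})%type.

Definition is_open_matching (n : nat) (D : diagram n) : bool :=
  [forall a in D.1, (a.1 < a.2)%N] &&
  [forall v : 'I_n,
     #|[set a in D.1 | (a.1 == v) || (a.2 == v)]| + (v \in D.2) == 1]%N.

(* i_1, ..., i_r, j_r, ..., j_1 for the sequence of arcs (i_1, j_1), ...,
   (i_r, j_r). *)
Definition nesting_word (n : nat) (s : seq ('I_n * 'I_n)) : seq nat :=
  [seq val a.1 | a <- s] ++ rev [seq val a.2 | a <- s].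

Definition is_nesting (n : nat) (D : diagram n) (s : seq ('I_n * 'I_n)) :
    bool :=
  all (fun a => a \in D.1) s && sorted ltn (nesting_word s).

Definition has_nesting (n : nat) (D : diagram n) (r : nat) : bool :=
  [exists s : r.-tuple ('I_n * 'I_n), is_nesting D s].

(* A future (k + 1)-nesting: a < i_1 < ... < i_k < j_k < ... < j_1.  For k = 0 the
   word is empty, so every open arc is a future 1-nesting. *)
Definition has_future_nesting (n : nat) (D : diagram n) (k : nat) : bool :=
  [exists a in D.2, exists s : k.-tuple ('I_n * 'I_n),
     is_nesting D s && path ltn a (nesting_word s)].

Definition is_nonnesting_diagram (n k m : nat) (D : diagram n) : bool :=
  [&& is_open_matching D,
      #|D.2| == m,
      ~~ has_nesting D k.+1
    & ~~ has_future_nesting D k].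

Definition nonnesting_diagram (n k m : nat) : Type :=
  {D : diagram n | is_nonnesting_diagram k m D}.

(* Main.v *)
Require Import Defs.
From mathcomp Require Import all_boot all_order all_algebra.
From mathcomp Require Import zify.

(** Growth diagrams in the sense of Fomin.  Draw a cell for every pair of
vertices and mark those of the closed arcs.  Shapes on the corners of the
resulting staircase, two neighbours being equal or differing by a box, are made
to obey a local rule through which three corners and the marking of a cell
determine its outer corner, while its two middle corners and its outer corner
determine the marking and the fourth corner.  The shapes on one side are empty,
those on the other side are one-row shapes counting the open arcs, and the
tableau is read on the diagonal; so the diagram and the tableau determine each
other.  With the rule chosen here, the number of rows at a corner obeys the same
recursion as the size of the largest nesting in the corresponding region, an
open arc being allowed as the outermost one.  A walk is the sequence of the
points [la + delta]. *)

Set Implicit Arguments.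
Unset Strict Implicit.
Unset Printing Implicit Defensive.

(** * Shapes *)

Notation row_len := (nth 0).

Lemma shapeP la :
  reflect ((forall i, row_len la i.+1 <= row_len la i) /\ 0 \notin la)
          (is_shape la).
Proof.
rewrite /is_shape andbC; case: (boolP (0 \in la)) => h0 /=.
  by constructor => -[].
apply: (iffP (sortedP 0)) => [srt|[srt _] i _]; last exact: srt.
split=> // i; have [lt|ge] := ltnP i.+1 (size la); first exact: srt.
by rewrite nth_default.
Qed.

Lemma row_len_mono la i j :
  is_shape la -> i <= j -> row_len la j <= row_len la i.
Proof.
case/shapeP => mono _ /subnKC <-.
by elim: (j - i) => [|d IH]; rewrite ?addn0 // addnS (leq_trans (mono _)).
Qed.

Lemma row_len_gt0 la i : is_shape la -> (0 < row_len la i) = (i < size la).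
Proof.
case/shapeP => _ la0; have [lt|ge] := ltnP i (size la).
  by rewrite lt0n; apply: contraNneq la0 => <-; rewrite mem_nth.
by rewrite nth_default.
Qed.

Lemma shape_ext la mu :
  is_shape la -> is_shape mu -> row_len la =1 row_len mu -> la = mu.
Proof.
move=> sl sm e.
have lt_iff i : (i < size la) = (i < size mu) by rewrite -!row_len_gt0 // e.
apply: (@eq_from_nth _ 0) => //.
have := lt_iff (size la); have := lt_iff (size mu); rewrite !ltnn; lia.
Qed.

Lemma is_shape_incr la r : is_shape la ->
  is_shape (incr_nth la r) = (r == 0) || (row_len la r < row_len la r.-1).
Proof.
move=> sl; apply/idP/idP => [/shapeP[mono _]|h].
  case: r mono => //= r /(_ r); rewrite !nth_incr_nth eqxx eq_sym.
  by rewrite (ltn_eqF (ltnSn r)).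
have [mono la0] := shapeP _ sl; apply/shapeP; split=> [i|].
  rewrite !nth_incr_nth; have := mono i.
  by case: (eqVneq r i.+1) h => [->|_ _] /=; case: eqP; lia.
have rle : r <= size la.
  case/orP: h => [/eqP-> //|h].
  by case: r h => // r h; rewrite -row_len_gt0 //= (leq_trans _ h).
apply/negP => /(nthP 0)[i]; rewrite size_incr_nth nth_incr_nth => lti.
have := row_len_gt0 i sl; case: ifP lti; lia.
Qed.

Lemma sumn_incr_nth la r : sumn (incr_nth la r) = (sumn la).+1.
Proof.
elim: la r => [|a la IH] [|r] //=; last by rewrite IH addnS.
by elim: r => //= r ->.
Qed.

Lemma incr_nth_neq la r : la == incr_nth la r = false.
Proof.
apply/negP => /eqP /(congr1 sumn); rewrite sumn_incr_nth; lia.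
Qed.

(** Shapes store no zero row, so the sequence stops at the first zero of [f]; [N] bounds the
    search. *)
Definition of_rows (f : nat -> nat) (N : nat) : seq nat :=
  mkseq f (find (fun i => f i == 0) (iota 0 N)).

Lemma row_len_of_rows f N : (forall i, f i.+1 <= f i) -> f N = 0 ->
  row_len (of_rows f N) =1 f.
Proof.
move=> mono fN i; rewrite /of_rows; set c := find _ _.
have [lt|ge] := ltnP i c; first by rewrite nth_mkseq.
rewrite nth_default ?size_mkseq //; apply/esym/eqP; rewrite -leqn0.
have fc : f c = 0.
  have [hh|hn] := boolP (has (fun i => f i == 0) (iota 0 N)).
    have := nth_find 0 hh; rewrite nth_iota ?add0n => [/eqP //|].
    by rewrite -[X in _ < X](size_iota 0 N) -has_find.
  by rewrite /c hasNfind // size_iota.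
rewrite -fc -(subnKC ge); elim: (i - c) => [|d IH]; rewrite ?addn0 // addnS.
exact: leq_trans IH.
Qed.

Lemma is_shape_of_rows f N : (forall i, f i.+1 <= f i) -> f N = 0 ->
  is_shape (of_rows f N).
Proof.
move=> mono fN; apply/shapeP; split=> [i|]; first by rewrite !row_len_of_rows.
apply/negP => /mapP[i]; rewrite mem_iota add0n => /= lt.
move/esym/eqP; have := before_find 0 lt; rewrite nth_iota ?add0n => [->//|].
by apply: leq_trans lt _; rewrite -[X in _ <= X](size_iota 0 N) find_size.
Qed.

Definition remove_box (la : seq nat) (r : nat) : seq nat :=
  of_rows (fun i => row_len la i - (r == i)) (size la).

Section RemoveBox.
Variables (la : seq nat) (r : nat).
Hypotheses (sl : is_shape la) (corner : row_len la r.+1 < row_len la r).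

Let mono i : row_len la i.+1 - (r == i.+1) <= row_len la i - (r == i).
Proof.
have := row_len_mono sl (leqnSn i).
by case: (eqVneq r i) => [<-|_]; case: eqP => /= _; move: corner; lia.
Qed.

Let row_end : row_len la (size la) - (r == size la) = 0.
Proof. by rewrite nth_default. Qed.

Lemma row_len_remove i : row_len (remove_box la r) i = row_len la i - (r == i).
Proof. by rewrite row_len_of_rows. Qed.

Lemma is_shape_remove : is_shape (remove_box la r).
Proof. exact: is_shape_of_rows. Qed.

Lemma remove_boxK : incr_nth (remove_box la r) r = la.
Proof.
have rowE : row_len (incr_nth (remove_box la r) r) =1 row_len la.
  move=> i; rewrite nth_incr_nth row_len_remove.
  by case: eqP => [<-|]; move: corner; lia.
apply: shape_ext rowE => //; rewrite is_shape_incr ?is_shape_remove //.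
rewrite !row_len_remove eqxx; case: (posnP r) => //= rgt0.
have := row_len_mono sl (leq_pred r); move: corner; case: eqP; lia.
Qed.

End RemoveBox.

Lemma corner_incr la r : is_shape la ->
  row_len (incr_nth la r) r.+1 < row_len (incr_nth la r) r.
Proof.
move=> sl; rewrite !nth_incr_nth eqxx (ltn_eqF (ltnSn r)).
exact: (row_len_mono sl).
Qed.

Lemma incr_nthK la r : is_shape la -> is_shape (incr_nth la r) ->
  remove_box (incr_nth la r) r = la.
Proof.
move=> sl si; have c := corner_incr r sl.
apply: shape_ext => //; first exact: is_shape_remove.
by move=> i; rewrite row_len_remove // nth_incr_nth addKn.
Qed.

(* [count (leq v) la] is the length of column [v] of [la]. *)
Lemma ltn_count_leq la v i : is_shape la -> 0 < v ->
  (i < count (leq v) la) = (v <= row_len la i).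
Proof.
move=> /andP[srt _] v0; elim: la i srt => [|b la IH] i.
  by rewrite nth_nil /=; lia.
move=> /[dup] /path_sorted/IH{}IH /=.
move=> /(order_path_min (rev_trans leq_trans)) /allP ub.
case: (leqP v b) => vb; first by case: i => //= i; rewrite ltnS IH.
rewrite add0n (@eq_in_count _ _ pred0) ?count_pred0; last first.
  by move=> c /ub /=; lia.
case: i => [|i] /=; first by lia.
have [lt|ge] := ltnP i (size la); last by rewrite nth_default; lia.
by have := ub _ (mem_nth 0 lt); move=> /=; lia.
Qed.

(* The first and the last row of [la] of length [v]. *)
Definition top_row (la : seq nat) (v : nat) : nat := count (leq v.+1) la.
Definition bottom_row (la : seq nat) (v : nat) : nat := (count (leq v) la).-1.

(** Rows above the topmost row of a given length are strictly longer, so that row can receive a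
    box. *)
Lemma top_rowP la r : is_shape la -> 0 < row_len la r ->
  let s := top_row la (row_len la r) in
  row_len la s = row_len la r /\ is_shape (incr_nth la s).
Proof.
move=> sl r0 s; have ltsE i : (i < s) = (row_len la r < row_len la i).
  exact: ltn_count_leq.
split; last first.
  rewrite is_shape_incr //; case: (posnP s) => //= s0.
  have := ltsE s; rewrite ltnn; have := ltsE s.-1; rewrite prednK // leqnn; lia.
have := ltsE s; rewrite ltnn; have := ltsE r; rewrite ltnn => rs.
have := @row_len_mono la s r sl; lia.
Qed.

Lemma bottom_rowP la r : is_shape la -> 0 < row_len la r ->
  let s := bottom_row la (row_len la r) in
  row_len la s = row_len la r /\ row_len la s.+1 < row_len la s.
Proof.
move=> sl r0 s; have ltsE i : (i < count (leq (row_len la r)) la)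
  = (row_len la r <= row_len la i) by exact: ltn_count_leq.
have c0 : 0 < count (leq (row_len la r)) la.
  by have := ltsE r; rewrite leqnn; apply: leq_ltn_trans.
have cs : count (leq (row_len la r)) la = s.+1 by rewrite prednK.
move: ltsE; rewrite cs => ltsE.
have := ltsE s; have := ltsE s.+1; have := ltsE r; have := @row_len_mono la r s sl.
rewrite leqnn; lia.
Qed.

(** A row that can receive a box is strictly shorter than the one above it, hence topmost of its
    length: the column of a new box determines its row. *)
Lemma top_row_uniq la r : is_shape la -> is_shape (incr_nth la r) ->
  0 < row_len la r -> top_row la (row_len la r) = r.
Proof.
move=> sl; rewrite is_shape_incr // => ad r0.
have ltsE i : (i < top_row la (row_len la r)) = (row_len la r < row_len la i).
  exact: ltn_count_leq.
have := ltsE r; rewrite ltnn; have := ltsE r.-1.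
case/orP: ad => [/eqP->|->]; lia.
Qed.

Lemma bottom_row_uniq la r : is_shape la -> row_len la r.+1 < row_len la r ->
  bottom_row la (row_len la r) = r.
Proof.
move=> sl c; have r0 : 0 < row_len la r by exact: leq_ltn_trans c.
have ltsE i : (i < count (leq (row_len la r)) la)
  = (row_len la r <= row_len la i) by exact: ltn_count_leq.
have := ltsE r; have := ltsE r.+1; rewrite /bottom_row leqnn; lia.
Qed.

(** * Local rule *)

Definition weak_step (la mu : seq nat) : Prop :=
  la = mu \/ exists r, mu = incr_nth la r.

Definition added_row (la mu : seq nat) : nat :=
  find (fun r => mu == incr_nth la r) (iota 0 (size mu)).

Lemma added_rowE la r : added_row la (incr_nth la r) = r.
Proof.
rewrite /added_row; set a := fun _ => _; set s := iota _ _.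
have hs : has a s.
  apply/hasP; exists r; last exact: eqxx.
  by rewrite mem_iota size_incr_nth; case: ifP; lia.
have := nth_find 0 hs; rewrite /s nth_iota; last first.
  by move: hs; rewrite has_find size_iota.
by move/eqP/incr_nth_inj; rewrite add0n.
Qed.

(* The cells of a growth diagram: [cell x al be ga de] has corners [al] (the
   smallest), [be] and [ga], and [de] (the largest), and is marked if [x].  This
   is Fomin's rule read on columns: a marked cell adds a box to the first column,
   and a box added on both sides gives one in the next column.  So [de] has more
   rows than both [be] and [ga] only if the cell is marked. *)
Variant cell :
  bool -> seq nat -> seq nat -> seq nat -> seq nat -> Prop :=
| CellMarked al of is_shape al : cell true al al al (incr_nth al (size al))
| CellLeft al be of is_shape al & is_shape be & weak_step al be :
    cell false al be al be
| CellRight al ga of is_shape al & is_shape ga & weak_step al ga :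
    cell false al al ga ga
| CellDistinct al r s of r != s & is_shape al & is_shape (incr_nth al r)
    & is_shape (incr_nth al s) & is_shape (incr_nth (incr_nth al r) s) :
    cell false al (incr_nth al r) (incr_nth al s)
      (incr_nth (incr_nth al r) s)
| CellEqual al r s of is_shape al & is_shape (incr_nth al r)
    & is_shape (incr_nth (incr_nth al r) s)
    & row_len (incr_nth al r) s = row_len (incr_nth al r) r :
    cell false al (incr_nth al r) (incr_nth al r)
      (incr_nth (incr_nth al r) s).

(** If both sides add a box in row [r], it lies in column [row_len be r]; the topmost row of that
    length receives the new box, which falls in the next column. *)
Definition grow (x : bool) (al be ga : seq nat) : seq nat :=
  if x then incr_nth al (size al)
  else if al == be then ga
  else if al == ga then be
  else let r := added_row al be in let s := added_row al ga in
  incr_nth be (if r == s then top_row be (row_len be r) else s).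

(** For equal rows, the box of [de] over [be] lies in column [row_len be s + 1]. If this is the
    first column, the cell was marked; otherwise the bottom box of the preceding column is
    removed. *)
Definition shrink (be ga de : seq nat) : bool * seq nat :=
  if be == de then (false, ga)
  else if ga == de then (false, be)
  else let r := added_row ga de in let s := added_row be de in
  if r != s then (false, remove_box be r)
  else if row_len be s == 0 then (true, be)
  else (false, remove_box be (bottom_row be (row_len be s))).

Lemma cell_corners x al be ga de : cell x al be ga de ->
  [/\ is_shape al, is_shape be, is_shape ga & is_shape de] /\
  [/\ weak_step al be, weak_step al ga, weak_step be de & weak_step ga de].
Proof.
have weak_refl la : weak_step la la by left.
have weak_incr la r : weak_step la (incr_nth la r) by right; exists r.
case=> [{}al sl|{}al {}be|{}al {}ga|{}al r s _|{}al r s] //.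
- do !split=> //; rewrite is_shape_incr // nth_default // row_len_gt0 //.
  by case: (size al) => //= p; exact: ltnSn.
- by move=> *; do !split=> //; rewrite incr_nthC.
Qed.

(** Balance of boxes around a cell; summed along a line of cells it counts arcs. *)
Lemma cell_sumn x al be ga de : cell x al be ga de ->
  sumn de + sumn al = sumn be + sumn ga + x.
Proof. case=> *; rewrite ?sumn_incr_nth; lia. Qed.

Lemma size_incr_shape la r : is_shape la -> is_shape (incr_nth la r) ->
  size (incr_nth la r) = size la + (r == size la).
Proof.
move=> sl; rewrite is_shape_incr // size_incr_nth => h.
suff: r <= size la by case: ltngtP; lia.
by case: r h => //= r h; rewrite -row_len_gt0 //; lia.
Qed.

(** This is the recursion that nestings obey: only a marking can give [de] more rows than both [be]
    and [ga], and then one more than [al]. *)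
Lemma leq_size_cell x al be ga de r : cell x al be ga de ->
  (r < size de) = [|| x && (r <= size al), r < size ga | r < size be].
Proof.
case=> [{}al sl|{}al {}be sl sb w|{}al {}ga sl sb w|
  {}al p q npq sl sp sq spq|{}al p q sl sp spq e].
- by rewrite size_incr_nth ltnn /=; lia.
- case: w => [->|[p pE]]; first by rewrite orbb.
  by subst be; rewrite size_incr_shape //; case: eqP => _ /=; lia.
- case: w => [->|[p pE]]; first by rewrite orbb.
  by subst ga; rewrite size_incr_shape //; case: eqP => _ /=; lia.
- have := size_incr_shape sp spq; have := size_incr_shape sl sp.
  have := size_incr_shape sl sq; have := size_incr_nth al q; move: npq.
  by case: (ltnP q) => ? /eqP npq -> ; do !case: eqP => ? /=; lia.
(* Row [q] is as long as the nonempty row [p], so it is not a new row. *)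
- rewrite (size_incr_shape sp spq) orbb; case: eqP => qE; last by rewrite addn0.
  have := corner_incr p sl; rewrite -e qE (nth_default _ (leqnn _)); lia.
Qed.

Lemma cell_grow x al be ga de : cell x al be ga de -> de = grow x al be ga.
Proof.
case=> [{}al|{}al {}be|{}al {}ga|{}al r s|{}al r s]; rewrite /grow //.
- by rewrite eqxx; case: eqP.
- by rewrite eqxx.
- by move=> /negPf rs *; rewrite !incr_nth_neq !added_rowE rs.
- move=> sl sr srs e; rewrite !incr_nth_neq !added_rowE eqxx -e.
  rewrite top_row_uniq // e; have := corner_incr r sl; lia.
Qed.

Lemma cell_shrink x al be ga de : cell x al be ga de ->
  shrink be ga de = (x, al).
Proof.
case=> [{}al sl|{}al {}be|{}al {}ga|{}al r s|{}al r s]; rewrite /shrink.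
- by rewrite incr_nth_neq !added_rowE eqxx nth_default.
- by rewrite eqxx.
- by rewrite eqxx; case: eqP => // ->.
- move=> /negPf rs sl sr *; rewrite incr_nth_neq incr_nthC incr_nth_neq.
  by rewrite added_rowE incr_nthC added_rowE rs /= incr_nthK.
- move=> sl sr srs e; rewrite incr_nth_neq !added_rowE eqxx /= e.
  have c := corner_incr r sl; rewrite bottom_row_uniq // incr_nthK //.
  by case: eqP => // z; move: c; rewrite z.
Qed.

Lemma grow_cell (x : bool) al be ga :
  is_shape al -> is_shape be -> is_shape ga ->
  weak_step al be -> weak_step al ga ->
  (x -> be = al /\ ga = al) -> cell x al be ga (grow x al be ga).
Proof.
move=> sl sb sg wb wg; case: x => [[]// -> ->|_]; first exact: CellMarked.
rewrite /grow; case: eqP => [<-|nb]; first exact: CellRight.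
case: eqP => [<-|ng]; first exact: CellLeft.
case: wb => [//|[r rE]]; case: wg => [//|[s sE]]; subst be ga.
rewrite !added_rowE; case: (eqVneq r s) sg => [<-|rs] sg.
  have c := corner_incr r sl; have c0 := leq_ltn_trans (leq0n _) c.
  by have [e1 e2] := top_rowP sb c0; apply: CellEqual.
apply: CellDistinct => //; rewrite is_shape_incr //.
move: sg; rewrite is_shape_incr // !nth_incr_nth (negPf rs).
case: eqP => //=; lia.
Qed.

Lemma incr_nth_injl r la mu : is_shape la -> is_shape mu ->
  incr_nth la r = incr_nth mu r -> la = mu.
Proof.
move=> sl sm e; apply: shape_ext => // i.
by have /(congr1 (nth 0 ^~ i)) := e; rewrite /= !nth_incr_nth; lia.
Qed.

Lemma shrink_cell be ga de :
  is_shape be -> is_shape ga -> is_shape de ->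
  weak_step be de -> weak_step ga de ->
  cell (shrink be ga de).1 (shrink be ga de).2 be ga de.
Proof.
move=> sb sg sd wb wg; rewrite /shrink.
case: eqP wb => [e _|nb [//|[s sE]]]; first by subst de; exact: CellLeft.
case: eqP wg => [e _|ng [//|[r rE]]].
  by rewrite e; apply: CellRight => //; right; exists s.
have -> : added_row be de = s by rewrite sE added_rowE.
have -> : added_row ga de = r by rewrite rE added_rowE.
case: (eqVneq r s) => [rs|rs] /=.
  subst r; have gb : ga = be.
    by rewrite -(incr_nthK sg (r := s)) -?rE // sE incr_nthK // -sE.
  subst ga; subst de; case: posnP => [z|pos] /=.
    (* An empty row that can receive a box is the first one below the shape. *)
    suff -> : s = size be by exact: CellMarked.
    have := is_shape_incr s sb; rewrite sd z.
    have := row_len_gt0 s sb; have := row_len_gt0 s.-1 sb.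
    by rewrite z; case: (s) => /=; lia.
  have [e1 e2] := bottom_rowP sb pos; move: e1 e2; set p := bottom_row _ _ => e1 e2.
  rewrite -{2 3 4}(remove_boxK sb e2); apply: CellEqual; rewrite ?remove_boxK //.
  exact: is_shape_remove.
have rowE i : (s == i) + row_len be i = (r == i) + row_len ga i.
  by have /(congr1 (nth 0 ^~ i)) := esym sE; rewrite rE /= !nth_incr_nth.
(* Row [r] ends in a corner of [de], where it received a box over [ga]; deleting a box of row [s],
   distinct from [r], preserves this. *)
have c : row_len be r.+1 < row_len be r.
  have := corner_incr r sg; rewrite -rE sE !nth_incr_nth.
  by rewrite [s == r]eq_sym (negPf rs); case: eqP => /=; lia.
have sa := is_shape_remove sb c; have bE := remove_boxK sb c.
have gE : incr_nth (remove_box be r) s = ga.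
  apply: (incr_nth_injl (r := r)) => //; last by rewrite -rE sE incr_nthC bE.
  rewrite is_shape_incr // !row_len_remove // (negPf rs).
  move: sd; rewrite sE is_shape_incr //; case: posnP => //= s0.
  have := rowE s; have := rowE s.-1; have := row_len_mono sg (leq_pred s).
  rewrite eqxx (negPf rs) (gtn_eqF (_ : s.-1 < s)) ?prednK //.
  case: eqP => /=; lia.
have -> : de = incr_nth (incr_nth (remove_box be r) r) s by rewrite bE.
rewrite -{2}bE -gE; apply: CellDistinct; rewrite ?bE ?gE -?sE //.
Qed.

(** * Growth diagrams *)

Lemma weak_step_sumn la mu : weak_step la mu ->
  sumn la <= sumn mu <= (sumn la).+1.
Proof. by case=> [->|[r ->]]; rewrite ?sumn_incr_nth; lia. Qed.

Lemma weak_step_eq la mu : weak_step la mu -> sumn mu <= sumn la -> la = mu.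
Proof. by case=> [->//|[r ->]]; rewrite sumn_incr_nth ltnn. Qed.

Lemma weak_step_nil la : weak_step la [::] -> la = [::].
Proof. by move=> w; apply: weak_step_eq w _. Qed.

Lemma sumn_one_row m : sumn (one_row m) = m.
Proof. by case: m => //= m; rewrite /one_row /= addn0. Qed.

Lemma size_one_row m : size (one_row m) = (0 < m).
Proof. by case: m. Qed.

Lemma is_shape_one_row m : is_shape (one_row m).
Proof. by case: m. Qed.

Lemma weak_step_one_row m (b : bool) : weak_step (one_row m) (one_row (m + b)).
Proof.
by case: b; rewrite ?addn1 ?addn0; [right; exists 0; case: m | left].
Qed.

Lemma weak_step_to_one_row la m : is_shape la -> weak_step la (one_row m) ->
  la = one_row (sumn la).
Proof.
move=> sl [->|[r e]]; first by rewrite sumn_one_row.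
have := congr1 size e; rewrite size_one_row size_incr_nth.
case: la e sl => [|a [|b la]] //= e sl; last by case: m e; case: ifP => //=; lia.
by move: sl; rewrite addn0; case: a e.
Qed.

(* [big_ord_recr] for [addn] itself, so that [lia] recognises the sums. *)
Lemma sum_ordS (F : nat -> nat) i :
  \sum_(u < i.+1) F u = \sum_(u < i) F u + F i.
Proof. exact: big_ord_recr. Qed.

Lemma sum_nat_cat (F : nat -> nat) a b c : a <= b <= c ->
  \sum_(a <= u < c) F u = \sum_(a <= u < b) F u + \sum_(b <= u < c) F u.
Proof. by case/andP=> ab bc; rewrite (big_cat_nat ab bc). Qed.

(* Vertices are numbered from 0, and [S i t] is defined for [i <= t <= n]: it is
   the shape of the vertices before [i] that are open or matched to a vertex
   [>= t].  The tableau is read on the diagonal, and [A u v] marks the cell with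
   corners [S u v.+1], [S u.+1 v.+1], [S u v], [S u.+1 v]. *)
Record growth (n : nat) (A : rel nat) (O : pred nat)
    (S : nat -> nat -> seq nat) : Prop := Growth {
  growth_arc : forall u v, A u v -> u < v < n;
  growth_cell : forall u v, u < v < n ->
    cell (A u v) (S u v.+1) (S u.+1 v.+1) (S u v) (S u.+1 v);
  growth_up : forall v, v < n -> weak_step (S v v.+1) (S v.+1 v.+1);
  growth_down : forall v, v < n -> weak_step (S v v.+1) (S v v);
  growth_diag : forall v, v < n ->
    sumn (S v v) + sumn (S v.+1 v.+1) = (sumn (S v v.+1)).*2.+1;
  growth_left : forall t, t <= n -> S 0 t = [::];
  growth_top : forall i, i <= n -> S i n = one_row (\sum_(j < i) O j);
  growth_shape : forall i t, i <= t <= n -> is_shape (S i t) }.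

Definition matching (n : nat) (A : rel nat) (O : pred nat) : Prop :=
  (forall u v, A u v -> u < v < n) /\
  (forall v, v < n ->
     O v + \sum_(u < v) A u v + \sum_(v.+1 <= w < n) A v w = 1).

(** Telescoping [cell_sumn], the differences in [i] count the arcs leaving a vertex, open one
    included, and those in [t] the arcs arriving; [growth_diag] then says that each vertex has
    degree one. *)
Lemma growth_matching n A O S : growth n A O S -> matching n A O.
Proof.
case=> arc cl up dn dg lf tp _; split=> // v vn.
have hor i t : i < t <= n ->
    sumn (S i.+1 t) = sumn (S i t) + O i + \sum_(t <= w < n) A i w.
  case/andP=> + tn; move e: (n - t) => d; elim: d t e tn => [|d IH] t e tn it.
    have -> : t = n by lia.
    by rewrite big_geq // !tp ?sumn_one_row ?big_ord_recr /=; lia.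
  rewrite big_ltn; last by lia.
  have := cell_sumn (cl i t _); have := IH t.+1; lia.
have ver i t : i <= t < n -> sumn (S i t) = sumn (S i t.+1) + \sum_(u < i) A u t.
  elim: i => [|i IH] it; first by rewrite big_ord0 !lf //; lia.
  have {}IH := IH (ltac:(lia)); have := cell_sumn (cl i t it).
  rewrite (sum_ordS (fun u => A u t)) IH; lia.
have h := hor v v.+1; rewrite ltnSn vn in h; have {}h := h isT.
have l := ver v v; rewrite leqnn vn in l; have {}l := l isT.
have := dg v vn; rewrite h l -addnn; lia.
Qed.

(** * From diagrams to tableaux *)

(** The line at [t], computed left to right from [prev], the line at [t + 1]. *)
Fixpoint grid_row (f : pred nat) (prev : nat -> seq nat) (i : nat) : seq nat :=
  if i is i'.+1 then grow (f i') (prev i') (prev i) (grid_row f prev i')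
  else [::].

Section Forward.
Variables (n : nat) (A : rel nat) (O : pred nat).

(** The recursion runs on [d = n - t], as the known line is the one at [t = n]. *)
Fixpoint grid_rows (d : nat) : nat -> seq nat :=
  if d is d'.+1 then grid_row (A^~ (n - d)) (grid_rows d')
  else fun i => one_row (\sum_(j < i) O j).

Definition grid (i t : nat) : seq nat := grid_rows (n - t) i.

Lemma grid_top i : grid i n = one_row (\sum_(j < i) O j).
Proof. by rewrite /grid subnn. Qed.

Lemma grid_left t : grid 0 t = [::].
Proof. by rewrite /grid; case: (n - t) => //=; rewrite big_ord0. Qed.

Lemma gridS u v : v < n ->
  grid u.+1 v = grow (A u v) (grid u v.+1) (grid u.+1 v.+1) (grid u v).
Proof.
by move=> vn; rewrite /grid -(subnSK vn) /= (subnSK vn) subKn // ltnW.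
Qed.

(** Uniqueness: [cell_grow] propagates the values from the left side and the top line to every
    corner. *)
Lemma growth_grid S : growth n A O S ->
  forall i t, i <= t <= n -> S i t = grid i t.
Proof.
case=> _ cl _ _ _ lf tp _ i t.
move e: (n - t) => d; elim: d i t e => [|d IHd] i t e itn.
  have -> : t = n by lia.
  by rewrite grid_top tp //; lia.
elim: i itn => [|i IHi] itn; first by rewrite grid_left lf //; lia.
rewrite gridS ?(cell_grow (cl i t _)); try lia.
by rewrite (IHd i t.+1) ?(IHd i.+1 t.+1) ?IHi //; lia.
Qed.

Hypothesis mt : matching n A O.

(** Existence: [grow] yields a cell if its three corners agree whenever the cell is marked. To
    ensure this, box counts are carried through the induction along with the shapes. *)
Lemma matching_grid : growth n A O grid.
Proof.
have [arc deg] := mt.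
pose hor t := (forall i, i <= t -> is_shape (grid i t)) /\
  (forall i, i < t -> weak_step (grid i t) (grid i.+1 t) /\
     sumn (grid i.+1 t) = sumn (grid i t) + O i + \sum_(t <= w < n) A i w).
pose ver i t := [/\ is_shape (grid i t), weak_step (grid i t.+1) (grid i t)
  & sumn (grid i t) = sumn (grid i t.+1) + \sum_(u < i) A u t].
have cl u v : u < v < n -> hor v.+1 -> ver u v ->
    cell (A u v) (grid u v.+1) (grid u.+1 v.+1) (grid u v) (grid u.+1 v).
  move=> uvn [sh nx] [sg w2 e2]; have [|w1 e1] := nx u; first by lia.
  rewrite (@gridS u v); last by lia.
  apply: grow_cell; rewrite ?sh //; try lia.
  (* The arc uses up the degree of both its ends, so no other arc accounts for a box between
     [grid u v.+1] and its two neighbours: both steps are trivial. *)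
  move=> Auv; have := deg u; have := deg v.
  rewrite -(big_mkord xpredT (fun w => nat_of_bool (A w v))).
  rewrite (@sum_nat_cat _ 0 u v) ?(@big_ltn _ _ _ u v); try lia.
  rewrite (@sum_nat_cat _ u.+1 v n) ?(@big_ltn _ _ _ v n) ?Auv; try lia.
  rewrite big_mkord => dv du; split; symmetry; apply: weak_step_eq => //; lia.
have ver_hor v : v < n -> hor v.+1 -> forall i, i <= v -> ver i v.
  move=> vn hv; elim=> [|i IH] iv.
    by rewrite /ver !grid_left big_ord0; split=> //; left.
  have c : cell _ _ _ _ _ := cl i v (ltac:(lia)) hv (IH (ltnW iv)).
  have [[_ _ _ sd] [_ _ w _]] := cell_corners c; split=> //.
  have := cell_sumn c; have [_ _ ->] := IH (ltnW iv).
  rewrite (sum_ordS (fun u => A u v)); lia.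
have hors t : t <= n -> hor t.
  move=> tn; rewrite -(subKn tn); move: (n - t) (leq_subr t n) => d.
  elim: d => [|d IH] dn.
    rewrite subn0; split=> i _; rewrite !grid_top ?is_shape_one_row //.
    rewrite (sum_ordS O) !sumn_one_row big_geq // addn0.
    by split=> //; apply: weak_step_one_row.
  move: IH; rewrite -(subnSK dn); set v := n - d.+1 => /(_ (ltnW dn)) hv.
  have vn : v < n by lia.
  have vr := ver_hor v vn hv; split=> i iv; first by case: (vr i iv).
  have c : cell _ _ _ _ _ := cl i v (ltac:(lia)) hv (vr i (ltnW iv)).
  have [_ [_ _ _ w]] := cell_corners c; split=> //.
  have := cell_sumn c; have [_ _ ->] := vr i (ltnW iv).
  have [_ /(_ i)[|_ ->]] := hv; first by lia.
  rewrite (@big_ltn _ _ _ v n) //; lia.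
split=> //.
- move=> u v uvn; apply: cl => //; first by apply: hors; lia.
  by apply: ver_hor; [lia | apply: hors; lia | lia].
- by move=> v vn; have [_ /(_ v (leqnn _))[]] := hors v.+1 vn.
- by move=> v vn; have [] := ver_hor v vn (hors _ vn) v (leqnn _).
- move=> v vn; have [_ _ ->] := ver_hor v vn (hors _ vn) v (leqnn _).
  have [_ /(_ v (leqnn _))[_ ->]] := hors v.+1 vn.
  by have := deg v vn; rewrite -addnn; lia.
- by move=> t _; apply: grid_left.
- by move=> i _; apply: grid_top.
- by move=> i t /andP[it tn]; have [/(_ i it)] := hors t tn.
Qed.

End Forward.
(** * From tableaux to diagrams *)

Section Backward.
Variables (n : nat) (la : nat -> seq nat).

(* [skew s i] is the corner [(i, i + s)]. *)
Fixpoint skew (s i : nat) : seq nat :=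
  if s isn't s1.+1 then la i
  else if s1 isn't s2.+1 then
    if sumn (la i) < sumn (la i.+1) then la i else la i.+1
  else (shrink (skew s1 i.+1) (skew s1 i) (skew s2 i.+1)).2.

Definition cogrid (i t : nat) : seq nat := skew (t - i) i.

Definition tableau_arc : rel nat := fun u v =>
  (u < v < n) &&
  (shrink (cogrid u.+1 v.+1) (cogrid u v) (cogrid u.+1 v)).1.

Definition tableau_open : pred nat := fun i => cogrid i n != cogrid i.+1 n.

Lemma cogrid_diag i : cogrid i i = la i.
Proof. by rewrite /cogrid subnn. Qed.

Lemma cogrid_corner v : cogrid v v.+1 =
  if sumn (la v) < sumn (la v.+1) then la v else la v.+1.
Proof. by rewrite /cogrid subSnn. Qed.

Lemma cogrid_shrink u v : u < v -> cogrid u v.+1 =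
  (shrink (cogrid u.+1 v.+1) (cogrid u v) (cogrid u.+1 v)).2.
Proof.
move=> uv; rewrite /cogrid subSS subSn ?(ltnW uv) //.
by rewrite -(subnSK uv).
Qed.

(** Uniqueness from the diagonal: by [growth_diag] exactly one step at the corner [(v, v + 1)] is
    proper, so its shape is the smaller of the two neighbours; [cell_shrink] gives the other
    corners. *)
Lemma growth_cogrid A O S : growth n A O S ->
  (forall i, i <= n -> S i i = la i) ->
  forall i t, i <= t <= n -> S i t = cogrid i t.
Proof.
case=> _ cl up dn dg _ _ _ diag.
(* Two successive diagonals are treated together, since [shrink] reads corners from both. *)
suff main s : forall i, i + s <= n -> S i (i + s) = cogrid i (i + s) /\
    (i + s < n -> S i (i + s).+1 = cogrid i (i + s).+1).
  move=> i t /andP[it tn]; have [] := main (t - i) i; rewrite subnKC //.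
elim: s => [|s IH] i; rewrite ?addn0 => isn.
  rewrite cogrid_diag diag //; split=> // lt; rewrite cogrid_corner -!diag //.
  have := dg i lt; have := weak_step_sumn (up i lt).
  have := weak_step_sumn (dn i lt); rewrite -addnn => a b c.
  by case: ltnP => d;
    [apply: weak_step_eq (dn i lt) _ | apply: weak_step_eq (up i lt) _]; lia.
rewrite addnS in isn *; have [|_ /(_ isn) e] := IH i; first by lia.
split=> // lt; rewrite cogrid_shrink; last by lia.
have [|e1 e2] := IH i.+1; first by lia.
move: e1 e2; rewrite !addSn => e1 /(_ lt) e2.
by rewrite -e -e1 -e2 (cell_shrink (cl i _ _)) //; lia.
Qed.

Variable m : nat.
Hypothesis la0 : la 0 = [::].
Hypothesis lan : la n = one_row m.
Hypothesis la_shape : forall i, i <= n -> is_shape (la i).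
Hypothesis la_step : forall i, i < n ->
  exists r, la i.+1 = incr_nth (la i) r \/ la i = incr_nth (la i.+1) r.

(** Existence: [good u v] describes the corner [(u, v + 1)] and spreads from the diagonal by
    [shrink_cell]. *)
Lemma growth_tableau : growth n tableau_arc tableau_open cogrid.
Proof.
pose good u v := [/\ is_shape (cogrid u v.+1), is_shape (cogrid u.+1 v.+1),
  weak_step (cogrid u v.+1) (cogrid u v) &
  weak_step (cogrid u v.+1) (cogrid u.+1 v.+1)].
(* With [v.-1], the first [good] speaks of the corner [(u, v)]. *)
have cl u v : u < v < n -> good u v.-1 -> good u.+1 v ->
    cell (shrink (cogrid u.+1 v.+1) (cogrid u v) (cogrid u.+1 v)).1
      (cogrid u v.+1) (cogrid u.+1 v.+1) (cogrid u v) (cogrid u.+1 v).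
  case/andP=> uv vn [s1 s2 _ w1] [s3 _ w2 _]; rewrite (@cogrid_shrink u v) //.
  by move: s1 s2 w1; rewrite prednK ?(leq_ltn_trans _ uv) // => *; apply: shrink_cell.
have corner v : v < n -> good v v.
  move=> vn; rewrite /good !cogrid_diag cogrid_corner.
  have [r [e|e]] := la_step vn; rewrite e sumn_incr_nth ?ltnSn -?e.
    by split; rewrite ?la_shape //; [exact: ltnW|left|right; exists r].
  rewrite ltnNge ltnW //=.
  by split; rewrite ?la_shape //; [right; exists r|left].
have goods s : forall u, u + s < n -> good u (u + s).
  elim: s => [|s IH] u un; first by rewrite addn0 in un *; exact: corner.
  have lt : u < u + s.+1 < n by lia.
  have g1 := IH u (ltac:(lia)); have g2 := IH u.+1 (ltac:(lia)).
  have [] := cell_corners (cl u (u + s.+1) lt _ _); rewrite ?addnS -?addSn //.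
  by case=> ? ? ? ? [? ? ? ?]; split.
have good' u v : u <= v < n -> good u v.
  by move=> uvn; have := goods (v - u) u; rewrite subnKC; [apply|]; lia.
have sh i t : i <= t <= n -> is_shape (cogrid i t).
  case/andP; rewrite leq_eqVlt => /orP[/eqP<-|it] tn.
    by rewrite cogrid_diag la_shape.
  by case: t it tn => // t it tn; have [] := good' i t (ltac:(lia)).
(* The shapes can only shrink as [t] grows, and the first one is empty. *)
have left0 t : t <= n -> cogrid 0 t = [::].
  elim: t => [|t IH] tn; first by rewrite cogrid_diag.
  have [_ _ + _] := good' 0 t tn; rewrite IH ?(ltnW tn) //; exact: weak_step_nil.
have top i : i < n -> weak_step (cogrid i n) (cogrid i.+1 n).
  by move=> lt; have [] := good' i n.-1 (ltac:(lia)); rewrite prednK //; lia.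
(* Going left from [(m)] the shapes can only shrink, so they keep at most one row. *)
have row d : d <= n -> cogrid (n - d) n = one_row (sumn (cogrid (n - d) n)).
  elim: d => [|d IH] dn.
    by rewrite subn0 cogrid_diag lan sumn_one_row.
  have := top (n - d.+1) (ltac:(lia)); rewrite (subnSK dn) IH ?(ltnW dn) //.
  by apply: weak_step_to_one_row; apply: sh; lia.
split=> //.
- by move=> u v /andP[].
- move=> u v uvn; rewrite /tableau_arc uvn /=.
  by apply: cl => //; apply: good'; lia.
- by move=> v vn; have [] := good' v v; rewrite ?leqnn.
- by move=> v vn; have [] := good' v v; rewrite ?leqnn.
- move=> v vn; rewrite !cogrid_diag cogrid_corner.
  have [r [->|->]] := la_step vn;
    rewrite sumn_incr_nth ?ltnSn ?(ltnNge _.+1) ?leqnSn /= -addnn; lia.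
- move=> i lin; rewrite -(subKn lin) row ?leq_subr // subKn //; congr one_row.
  elim: i lin => [|i IH] lin; first by rewrite big_ord0 left0.
  rewrite (sum_ordS tableau_open) -IH ?(ltnW lin) // /tableau_open.
  case: (top i lin) => [<-|[r ->]]; first by rewrite eqxx addn0.
  by rewrite incr_nth_neq sumn_incr_nth addn1.
Qed.

End Backward.

(** * Nestings *)

(* There are [r] nested arcs with left ends before [i] and right ends at or
   after [t], of which the outermost may be open. *)
Fixpoint nested (A : rel nat) (O : pred nat) (r i t : nat) : Prop :=
  if r is r'.+1 then
    (r' = 0 /\ exists2 u, u < i & O u) \/
    (exists u v, [/\ u < i, t <= v, A u v & nested A O r' u v.+1])
  else True.

(** No closed arc ends at or after [n], so only a single open arc can count, as in the one-row
    shapes of the top line. *)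
Lemma nested_ge (A : rel nat) (O : pred nat) n r i :
  (forall u v, A u v -> u < v < n) ->
  nested A O r i n <-> r <= (0 < \sum_(j < i) O j).
Proof.
move=> arc; case: r => [|r] /=; first by split=> // _; case: (0 < _).
have -> : (r < (0 < \sum_(j < i) O j)) = (r == 0) && [exists j : 'I_i, O j].
  rewrite lt0n sum_nat_eq0 negb_forall /=; under eq_existsb do rewrite eqb0 negbK.
  by case: existsP => _; case: r.
split=> [[[-> [u ui Ou]]|[u [v [_ nv /arc]]]]|/andP[/eqP-> /existsP[u Ou]]].
- by apply/existsP; exists (Ordinal ui).
- lia.
- by left; split=> //; exists u.
Qed.

(** [nested] peels off the innermost arc. For the corner [(i + 1, t)], a closed one is [(i, t)]
    itself, or starts before [i], or ends after [t]: these are the three terms of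
    [leq_size_cell]. *)
Lemma growth_nested n A O S : growth n A O S ->
  forall r i t, i <= t <= n -> (r <= size (S i t)) <-> nested A O r i t.
Proof.
case=> arc cl _ _ _ lf tp _ r i t; move e: (n - t) => d.
elim: d t i r e => [|d IHd] t i r e.
  move=> itn; have -> : t = n by lia.
  by rewrite tp ?size_one_row ?nested_ge //; lia.
elim: i r => [|i IHi] r itn.
  rewrite lf ?leqn0; last by lia.
  case: r => [|r] //=; split=> //; case=> [[_ [u]]|[u [v []]]]; lia.
have c : cell _ _ _ _ _ := cl i t (ltac:(lia)).
case: r => [//|r]; rewrite (leq_size_cell _ c).
have iA := IHd t.+1 i r (ltac:(lia)) (ltac:(lia)).
have iB := IHd t.+1 i.+1 r.+1 (ltac:(lia)) (ltac:(lia)).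
have iG := IHi r.+1 (ltac:(lia)).
split=> [/or3P[/andP[x /iA ne]|/iG ne|/iB]|].
- by right; exists i, t.
- case: ne => [[-> [u ui Ou]]|[u [v [ui tv Auv ne]]]].
    by left; split=> //; exists u => //; apply: ltnW.
  by right; exists u, v; split=> //; apply: ltnW.
- case=> [?|[u [v [ui tv Auv ne]]]]; first by left.
  by right; exists u, v; split=> //; apply: ltnW.
case=> [o|[u [v [ui tv Auv ne]]]].
  by apply/or3P; constructor 3; apply/iB; left.
case: (ltngtP t v) tv => // tv _.
  by apply/or3P; constructor 3; apply/iB; right; exists u, v.
rewrite -tv in Auv ne; move: ui; rewrite ltnS leq_eqVlt => /predU1P[ui|ui].
  by rewrite ui in Auv ne; apply/or3P; constructor 1; rewrite Auv; apply/iA.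
by apply/or3P; constructor 2; apply/iG; right; exists u, t.
Qed.

(** * Nestings of a diagram as sequences of arcs *)

Section DiagramArcs.
Variables (n : nat) (D : diagram n).

Definition has_arc : rel nat :=
  fun u v => [exists a in D.1, (val a.1 == u) && (val a.2 == v)].

Definition open_vertex : pred nat := fun u => [exists v in D.2, val v == u].

Lemma has_arcP (u v : 'I_n) : has_arc u v = ((u, v) \in D.1).
Proof.
apply/existsP/idP => [[[a b]] /= /andP[ab /andP[/eqP/val_inj<- /eqP/val_inj<-]]//|uv].
by exists (u, v); rewrite uv !eqxx.
Qed.

Lemma open_vertexP (u : 'I_n) : open_vertex u = (u \in D.2).
Proof.
apply/existsP/idP => [[a /andP[aD /eqP/val_inj<-]]//|uD].
by exists u; rewrite uD eqxx.
Qed.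

Lemma has_arc_lt u v : has_arc u v -> u < n /\ v < n.
Proof. by case/existsP=> -[a b] /andP[_ /andP[/eqP<- /eqP<-]]; rewrite !ltn_ord. Qed.

Definition nests (a b : 'I_n * 'I_n) : bool := (a.1 < b.1) && (b.2 < a.2).

Definition nested_seq (s : seq ('I_n * 'I_n)) (i t : nat) : bool :=
  [&& all (mem D.1) s, pairwise nests s
    & all (fun a : 'I_n * 'I_n => (a.1 < i) && (t <= a.2)) s].

(** Sequences list the arcs from the outermost inwards, so the arc peeled off by [nested] is the
    last one. In the second alternative an open arc surrounds all of [s]. *)
Lemma nestedP r i t : i <= n -> nested has_arc open_vertex r i t <->
  exists2 s, nested_seq s i t & size s = r \/ (size s).+1 = r /\
    exists2 o : 'I_n, (o \in D.2) && (o < i) & all (fun a : 'I_n * 'I_n => o < a.1) s.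
Proof.
elim: r i t => [|r IH] i t lin; split.
- by exists [::] => //; left.
- by [].
- case=> [[-> [u ui Ou]]|[u [v [ui tv Auv]]]].
    exists [::] => //; right; split=> //.
    by exists (Ordinal (leq_trans ui lin)); rewrite // -open_vertexP ui Ou.
  have [ltu ltv] := has_arc_lt Auv; case/(IH _ _ (ltnW ltu)) => s /and3P[sD ps sb] szs.
  pose a := (Ordinal ltu, Ordinal ltv).
  exists (rcons s a).
    rewrite /nested_seq all_rcons pairwise_rcons all_rcons sD ps /= ui tv.
    rewrite -has_arcP Auv /= andbT; apply/andP; split.
      by apply: sub_all sb => b.
    apply: sub_all sb => b /andP[b1 b2].
    by rewrite (ltn_trans b1 ui) (leq_trans tv (ltnW b2)).
  rewrite size_rcons; case: szs => [->|[sz [o /andP[oD ou] os]]]; first by left.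
  right; rewrite sz; split=> //; exists o; first by rewrite oD (ltn_trans ou).
  by rewrite all_rcons os andbT.
case=> s; case/lastP: s => [_ [//|[[<-] [o /andP[oD oi] _]]]|s a].
  by left; split=> //; exists o; rewrite ?open_vertexP.
rewrite /nested_seq all_rcons pairwise_rcons all_rcons.
case/and3P=> /andP[aD sD] /andP[an ps] /andP[/andP[ai ta] sb] sz.
right; exists a.1, a.2; split; rewrite // ?has_arcP -?surjective_pairing //.
apply/IH; first exact: ltnW.
exists s; first by rewrite /nested_seq sD ps /=; apply: sub_all an => b.
move: sz; rewrite size_rcons => -[[->]|[[sz] [o /andP[oD oi]]]]; first by left.
by rewrite all_rcons => /andP[oa os]; right; split=> //; exists o; rewrite ?oD.
Qed.

(** The [allrel] part is the increase across the middle of the word; it holds as soon as some [t]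
    separates left ends from right ends. *)
Lemma sorted_nesting_word (s : seq ('I_n * 'I_n)) :
  sorted ltn (nesting_word s) =
  pairwise nests s && allrel (fun a b : 'I_n * 'I_n => a.1 < b.2) s s.
Proof.
rewrite /nesting_word (sorted_pairwise ltn_trans) pairwise_cat.
rewrite -[pairwise _ (rev _)](sorted_pairwise ltn_trans) rev_sorted.
rewrite (sorted_pairwise (rev_trans ltn_trans)) !pairwise_map andbC -pairwise_relI.
congr (_ && _); rewrite allrel_mapl.
have -> : rev [seq val a.2 | a <- s] = [seq val a.2 | a <- rev s] by rewrite map_rev.
by rewrite allrel_mapr; apply/allrelP/allrelP => h a b; have := h a b; rewrite mem_rev.
Qed.

Lemma is_nesting_nested_seq s t : nested_seq s t t -> is_nesting D s.
Proof.
case/and3P=> sD ps /allP st; rewrite /is_nesting sorted_nesting_word sD ps /=.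
by apply/allrelP => a b /st/andP[+ _] /st/andP[_]; apply: leq_trans.
Qed.

Lemma nested_seq_is_nesting s : is_nesting D s -> exists2 t, t <= n &
  nested_seq s t t /\ forall o : 'I_n, all (fun a : 'I_n * 'I_n => o < a.1) s -> o < t.
Proof.
rewrite /is_nesting sorted_nesting_word => /and3P[sD ps /allrelP cr].
(* The empty nesting admits any cut, and [n] lies beyond every vertex [o]. *)
case/lastP: s sD ps cr => [|s a] sD ps cr; first by exists n.
(* The cut comes just after the largest left end, that of the innermost arc [a]. *)
exists a.1.+1; first exact: ltn_ord.
have aa : a \in rcons s a by rewrite mem_rcons mem_head.
split; last by move=> o; rewrite all_rcons => /andP[/ltnW].
rewrite /nested_seq sD ps /=; apply/allP => b bs; rewrite cr // andbT ltnS.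
move: ps bs; rewrite pairwise_rcons mem_rcons inE => /andP[/allP lt _].
by case/predU1P=> [->//|/lt/andP[/ltnW]].
Qed.

(** The open arc of a future nesting is the outermost of [k + 1] arcs, and the cut between left and
    right ends gives the diagonal position [t]. *)
Lemma has_nesting_nested k :
  has_nesting D k.+1 || has_future_nesting D k <->
  exists2 t, t <= n & nested has_arc open_vertex k.+1 t t.
Proof.
split.
  case/orP=> [/existsP[s ns]|/exists_inP[o oD /existsP[s /andP[ns]]]].
    have [t tn [nst _]] := nested_seq_is_nesting ns; exists t => //.
    by apply/nestedP => //; exists s => //; left; rewrite size_tuple.
  rewrite (path_sortedE ltn_trans) all_cat all_map => /andP[/andP[os _] _].
  have [t tn [nst ot]] := nested_seq_is_nesting ns; exists t => //.
  apply/nestedP => //; exists s => //; right; rewrite size_tuple; split=> //.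
  by exists o; rewrite ?oD ?ot.
case=> t tn /(nestedP _ _ tn)[s nst [sz|[[sz] [o /andP[oD ot] os]]]].
  apply/orP; left; apply/existsP; exists (tcast sz (in_tuple s)).
  by rewrite val_tcast; apply: is_nesting_nested_seq nst.
have ns := is_nesting_nested_seq nst.
apply/orP; right; apply/exists_inP; exists o => //.
apply/existsP; exists (tcast sz (in_tuple s)); rewrite val_tcast ns /=.
rewrite (path_sortedE ltn_trans); have [/andP[_ ->]] := ns; rewrite andbT.
rewrite all_cat all_map os all_rev all_map; apply/allP => a aS /=.
case/and3P: nst => _ _ /allP/(_ a aS)/andP[_]; exact: leq_trans.
Qed.

End DiagramArcs.

(** * Open matching diagrams and vertex degrees *)

Lemma card_pred_sum (T : finType) (P : pred T) : #|[set x | P x]| = \sum_x P x.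
Proof. by rewrite -sum1dep_card big_mkcond; apply: eq_bigr => x _; case: (P x). Qed.

(** Arcs at [v] end or start there, never both since [a.1 < a.2]; the same inequality truncates the
    two sums. *)
Lemma card_arcs_at n (D : diagram n) (v : 'I_n) :
  (forall a, a \in D.1 -> a.1 < a.2) ->
  #|[set a in D.1 | (a.1 == v) || (a.2 == v)]| =
  \sum_(u < v) has_arc D u v + \sum_(v.+1 <= w < n) has_arc D v w.
Proof.
move=> lt; have arc_lt' u w : has_arc D u w -> u < w.
  by case/existsP=> -[a b] /andP[/lt /= ab /andP[/eqP<- /eqP<-]].
have -> : [set a in D.1 | (a.1 == v) || (a.2 == v)] =
    [set (u, v) | u in [set u | has_arc D (val u) v]] :|:
    [set (v, w) | w in [set w | has_arc D v (val w)]].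
  apply/setP=> -[a b]; rewrite !inE /=; apply/andP/orP.
    case=> ab /orP[/eqP<-|/eqP<-].
      by right; apply/imsetP; exists b; rewrite // inE has_arcP.
    by left; apply/imsetP; exists a; rewrite // inE has_arcP.
  by case=> /imsetP[u]; rewrite inE has_arcP => uv [-> ->]; rewrite uv eqxx ?orbT.
rewrite cardsU card_imset; last by move=> ? ? [].
rewrite card_imset; last by move=> ? ? [].
rewrite (_ : _ :&: _ = set0) ?cards0 ?subn0; last first.
  apply/setP=> -[a b]; rewrite !inE; apply/andP.
  case=> /imsetP[u + [au _]] /imsetP[w _ [av _]].
  by rewrite inE -au av => /arc_lt'; rewrite ltnn.
rewrite !card_pred_sum; congr (_ + _).
  rewrite -!(big_mkord xpredT (fun u => nat_of_bool (has_arc D u v))).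
  rewrite (@sum_nat_cat _ 0 v n) ?(ltnW (ltn_ord v)) //.
  rewrite [X in _ + X]big_nat_cond [X in _ + X]big1 ?addn0 //.
  move=> w /andP[/andP[vw _] _]; apply/eqP; rewrite eqb0.
  by apply: contraL vw => /arc_lt'; rewrite -ltnNge.
rewrite -!(big_mkord xpredT (fun w => nat_of_bool (has_arc D v w))).
rewrite (@sum_nat_cat _ 0 v.+1 n) ?ltn_ord //.
rewrite [X in X + _]big_nat_cond [X in X + _]big1 //.
move=> w /andP[/andP[_ vw] _]; apply/eqP; rewrite eqb0.
by apply: contraL vw => /arc_lt'; rewrite -leqNgt.
Qed.

Lemma is_open_matchingP n (D : diagram n) :
  reflect (matching n (has_arc D) (open_vertex D)) (is_open_matching D).
Proof.
apply: (iffP andP) => [[/forall_inP lt /forallP deg]|[lt deg]].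
  split=> [u v|v vn].
    by case/existsP=> -[a b] /andP[/lt /= ab /andP[/eqP<- /eqP<-]]; rewrite ab ltn_ord.
  have /eqP := deg (Ordinal vn); rewrite card_arcs_at // -open_vertexP /=; lia.
have {}lt a : a \in D.1 -> a.1 < a.2.
  by case: a => a b; rewrite -has_arcP => /lt/andP[].
split; first exact/forall_inP.
apply/forallP=> v; rewrite card_arcs_at // -open_vertexP.
by rewrite addnC addnA deg.
Qed.

(** * Bijection between tableaux and diagrams *)

Section DiagramOf.
Variable n : nat.

Definition diagram_of (A : rel nat) (O : pred nat) : diagram n :=
  ([set a : 'I_n * 'I_n | A a.1 a.2], [set v : 'I_n | O v]).

Lemma has_arc_diagram_of (A : rel nat) O : (forall u v, A u v -> u < v < n) ->
  has_arc (diagram_of A O) =2 A.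
Proof.
move=> lt u v; apply/existsP/idP => [[[a b] /andP[]]|Auv].
  by rewrite inE => ab /andP[/eqP<- /eqP<-].
have /andP[uv vn] := lt _ _ Auv; exists (Ordinal (ltn_trans uv vn), Ordinal vn).
by rewrite inE !eqxx Auv.
Qed.

Lemma open_vertex_diagram_of A O u : u < n ->
  open_vertex (diagram_of A O) u = O u.
Proof. by move=> un; rewrite (open_vertexP _ (Ordinal un)) inE. Qed.

Lemma diagram_ofK (D : diagram n) (A : rel nat) (O : pred nat) :
  (forall u v, u < n -> v < n -> A u v = has_arc D u v) ->
  (forall u, u < n -> O u = open_vertex D u) -> diagram_of A O = D.
Proof.
case: D => D1 D2 eA eO; congr pair; apply/setP.
  by case=> a b; rewrite inE eA // has_arcP.
by move=> u; rewrite inE eO // open_vertexP.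
Qed.

Lemma growth_diagram_of A O S : growth n A O S ->
  growth n (has_arc (diagram_of A O)) (open_vertex (diagram_of A O)) S.
Proof.
case=> lt cl up dn dg lf tp sh; have eA := has_arc_diagram_of O lt; split=> //.
- by move=> u v; rewrite eA => /lt.
- by move=> u v uv; rewrite eA; apply: cl.
- move=> i lin; rewrite tp //; congr one_row; apply: eq_bigr => j _.
  by rewrite open_vertex_diagram_of // (leq_trans (ltn_ord j)).
Qed.

(** The corner [(n, n)] counts the open arcs, and by [growth_nested] a forbidden nesting amounts to
    a diagonal shape with more than [k] rows. *)
Lemma is_nonnesting_diagram_growth (D : diagram n) S k m :
  growth n (has_arc D) (open_vertex D) S ->
  is_nonnesting_diagram k m D =
  (S n n == one_row m) && [forall t : 'I_n.+1, size (S t t) <= k].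
Proof.
move=> gr; have [lt _ _ _ _ _ tp _] := gr.
rewrite /is_nonnesting_diagram.
have -> : is_open_matching D by exact/is_open_matchingP/growth_matching/gr.
rewrite -negb_or /=; congr (_ && _).
  rewrite tp // (_ : #|D.2| = \sum_(j < n) open_vertex D j).
    by apply/eqP/eqP => [->//|/(congr1 sumn)]; rewrite !sumn_one_row.
  rewrite -sum1_card big_mkcond; apply: eq_bigr => v _.
  by rewrite open_vertexP; case: (_ \in _).
apply/idP/forallP => [nn t|sz].
  rewrite leqNgt; apply: contra nn => lk; apply/has_nesting_nested.
  have tn : t <= n by rewrite -ltnS.
  by exists (val t) => //; apply/(growth_nested gr); rewrite ?leqnn.
apply/negP => /has_nesting_nested[t tn /(growth_nested gr)].
have := sz (Ordinal (tn : t < n.+1)); rewrite /= leqnn tn => h /(_ isT); lia.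
Qed.

Section Tableaux.
Variables k m : nat.

Definition tableau_diagram (t : n.+1.-tuple (seq nat)) : diagram n :=
  diagram_of (tableau_arc n (nth [::] t)) (tableau_open n (nth [::] t)).

Definition diagram_tableau (D : diagram n) : n.+1.-tuple (seq nat) :=
  [tuple grid n (has_arc D) (open_vertex D) i i | i < n.+1].

Lemma nth_diagram_tableau D i : i <= n ->
  nth [::] (diagram_tableau D) i = grid n (has_arc D) (open_vertex D) i i.
Proof.
move=> lin; have lt : i < n.+1 by [].
by rewrite -[i]/(val (Ordinal lt)) -tnth_nth tnth_mktuple.
Qed.

Lemma is_oscillating_tableauP (t : n.+1.-tuple (seq nat)) :
  reflect [/\ forall i, i <= n -> is_shape (nth [::] t i),
      forall i, i < n -> adds_box (nth [::] t i) (nth [::] t i.+1) ||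
        adds_box (nth [::] t i.+1) (nth [::] t i),
      forall i, i <= n -> size (nth [::] t i) <= k,
      nth [::] t 0 = [::] & nth [::] t n = one_row m]
    (is_oscillating_tableau k m t).
Proof.
rewrite /is_oscillating_tableau !(tnth_nth [::]) /=.
apply: (iffP and5P) => [|[h1 h2 h3 h4 h5]].
  case=> /(all_nthP [::]) h1 /(sortedP [::]) h2 /(all_nthP [::]) h3.
  move=> /eqP h4 /eqP h5.
  by split=> // i lin; [apply: h1|apply: h2|apply: h3]; rewrite size_tuple.
by split; [apply/(all_nthP [::])|apply/(sortedP [::])|apply/(all_nthP [::])
          |apply/eqP|apply/eqP];
  rewrite ?size_tuple.
Qed.

(** A box whose addition gives a shape lies at most one row below [la], which is the bound built
    into [adds_box]. *)
Lemma adds_boxP la mu : is_shape la -> is_shape mu ->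
  reflect (exists r, mu = incr_nth la r) (adds_box la mu).
Proof.
move=> sl sm; apply: (iffP existsP) => [[r /eqP ->]|[r e]]; first by exists r.
suff lt : r < (size la).+1 by exists (Ordinal lt); rewrite e.
rewrite ltnS; move: sm; rewrite e is_shape_incr //.
by case: r {e} => //= r; rewrite -row_len_gt0 //; lia.
Qed.

Lemma growth_oscillating_tableau (t : n.+1.-tuple (seq nat)) :
  is_oscillating_tableau k m t ->
  growth n (has_arc (tableau_diagram t)) (open_vertex (tableau_diagram t))
    (cogrid (nth [::] t)).
Proof.
case/is_oscillating_tableauP=> sh st _ t0 tn; apply: growth_diagram_of.
apply: growth_tableau t0 tn sh _ => i lin.
by case/orP: (st i lin) => /existsP[r /eqP e]; exists r; [left|right].
Qed.

Lemma tableau_diagramP (t : n.+1.-tuple (seq nat)) :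
  is_oscillating_tableau k m t ->
  is_nonnesting_diagram k m (tableau_diagram t).
Proof.
move=> tt; rewrite (is_nonnesting_diagram_growth _ _ (growth_oscillating_tableau tt)).
have /is_oscillating_tableauP[_ _ sz _ tn] := tt.
rewrite cogrid_diag tn eqxx; apply/forallP => i.
by rewrite cogrid_diag sz // -ltnS.
Qed.

Lemma growth_grid_diagram (D : diagram n) : is_nonnesting_diagram k m D ->
  growth n (has_arc D) (open_vertex D) (grid n (has_arc D) (open_vertex D)).
Proof. by case/and4P=> /is_open_matchingP/matching_grid. Qed.

Lemma diagram_tableauP (D : diagram n) : is_nonnesting_diagram k m D ->
  is_oscillating_tableau k m (diagram_tableau D).
Proof.
move=> Dn; have gr := growth_grid_diagram Dn.
move: Dn; rewrite (is_nonnesting_diagram_growth _ _ gr) => /andP[/eqP top /forallP sz].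
have [_ _ up dn dg lf _ sh] := gr.
apply/is_oscillating_tableauP; split=> [i lin|i lin|i lin||].
- by rewrite nth_diagram_tableau // sh ?leqnn.
- have shi := sh i i; rewrite leqnn (ltnW lin) in shi; have {}shi := shi isT.
  have shj := sh i.+1 i.+1; rewrite leqnn lin in shj; have {}shj := shj isT.
  rewrite !nth_diagram_tableau ?(ltnW lin) //.
  (* By [growth_diag] exactly one of the two steps at [(i, i + 1)] is proper; it tells whether a box
     is added or deleted. *)
  have := dg i lin; case: (up i lin) => [eu|[r eu]]; case: (dn i lin) => [ed|[s ed]].
  + by rewrite -eu -ed -addnn; lia.
  + by rewrite eu in ed => _; apply/orP; right; apply/(adds_boxP shj shi); exists s.
  + by rewrite ed in eu => _; apply/orP; left; apply/(adds_boxP shi shj); exists r.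
  + by rewrite eu ed !sumn_incr_nth -addnn; lia.
- by rewrite nth_diagram_tableau //; exact: (sz (Ordinal (lin : i < n.+1))).
- by rewrite nth_diagram_tableau // lf.
- by rewrite nth_diagram_tableau.
Qed.

Lemma tableau_diagramK (t : n.+1.-tuple (seq nat)) :
  is_oscillating_tableau k m t ->
  diagram_tableau (tableau_diagram t) = t.
Proof.
move=> tt; apply: eq_from_tnth => i; rewrite !(tnth_nth [::]).
have lin : i <= n by rewrite -ltnS.
rewrite nth_diagram_tableau // -(growth_grid (growth_oscillating_tableau tt)) ?leqnn //.
by rewrite cogrid_diag.
Qed.

Lemma diagram_tableauK (D : diagram n) : is_nonnesting_diagram k m D ->
  tableau_diagram (diagram_tableau D) = D.
Proof.
move=> Dn; have gr := growth_grid_diagram Dn; have [lt cl _ _ _ _ tp _] := gr.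
(* The growth of [D] is rebuilt from its diagonal, so [shrink] and the top line give back the arcs
   of [D]. *)
have gE := growth_cogrid gr (fun i lin => esym (nth_diagram_tableau D lin)).
apply: diagram_ofK => [u v un vn|u un].
  rewrite /tableau_arc; case: (boolP (u < v < n)) => [uvn|] /=.
    by rewrite -!gE ?(cell_shrink (cl _ _ uvn)) //; lia.
  by move=> nuv; case: (boolP (has_arc D u v)) => // /lt; rewrite (negPf nuv).
rewrite /tableau_open -!gE ?tp ?leqnn ?(ltnW un) ?un //.
rewrite (sum_ordS (open_vertex D)).
case: (open_vertex D u); last by rewrite addn0 eqxx.
by apply/eqP => /(congr1 sumn); rewrite !sumn_one_row; lia.
Qed.

End Tableaux.
End DiagramOf.

Import GRing.Theory Num.Theory Order.TTheory.

(** * Walks *)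

Section Points.
Variable k : nat.
Local Open Scope ring_scope.

Definition point (la : seq nat) : 'rV[int]_k :=
  \row_(i < k) (row_len la i + (k - i))%N%:Z.

(** The value 0 past the last coordinate gives [of_rows] the zero it expects at [k]. *)
Definition coord (x : 'rV[int]_k) (i : nat) : nat :=
  if (insub i : option 'I_k) is Some j then absz (x 0 j) else 0%N.

Definition shape_of_point (x : 'rV[int]_k) : seq nat :=
  of_rows (fun i => coord x i - (k - i))%N k.

Lemma coordE x (i : 'I_k) : coord x i = absz (x 0 i).
Proof. by rewrite /coord valK. Qed.

Lemma coord_point la i : (i < k)%N -> coord (point la) i = (row_len la i + (k - i))%N.
Proof. by move=> ik; rewrite -[i]/(val (Ordinal ik)) coordE mxE. Qed.

Lemma in_chamber_point la : is_shape la -> in_chamber (point la).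
Proof.
move=> sl; apply/andP; split.
  apply/forallP=> i; apply/forallP=> j; apply/implyP=> ij; rewrite !mxE ltz_nat.
  have := row_len_mono sl (ltnW ij); have := ltn_ord j; lia.
by apply/forallP=> i; rewrite mxE ltz_nat; have := ltn_ord i; lia.
Qed.

Section Chamber.
Variable x : 'rV[int]_k.
Hypothesis ch : in_chamber x.

Lemma coord_decr i : (i.+1 < k)%N -> (coord x i.+1 < coord x i)%N.
Proof.
move=> ik; have [/forallP mono /forallP pos] := andP ch.
rewrite -[i.+1]/(val (Ordinal ik)) -[i in (_ < coord x i)%N]/(val (Ordinal (ltnW ik))).
rewrite !coordE -ltz_nat !gtz0_abs ?pos //.
by have /forallP/(_ (Ordinal ik))/implyP -> := mono (Ordinal (ltnW ik)).
Qed.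

(** By induction from the last coordinate, which is at least 1. Hence the truncated subtraction in
    [shape_of_point] loses nothing. *)
Lemma coord_ge i : (k - i <= coord x i)%N.
Proof.
have [ik|] := ltnP i k; last by lia.
have [_ /forallP pos] := andP ch.
move e: (k - i.+1)%N => d; elim: d i ik e => [|d IH] i ik e.
  have := pos (Ordinal ik); rewrite -[i in coord x i]/(val (Ordinal ik)) coordE; lia.
have ik1 : (i.+1 < k)%N by lia.
have := IH i.+1 ik1 (ltac:(lia)); have := coord_decr ik1; lia.
Qed.

Let mono i : (coord x i.+1 - (k - i.+1) <= coord x i - (k - i))%N.
Proof.
have [ik|ik] := ltnP i.+1 k; first by have := coord_decr ik; lia.
by rewrite /coord insubF //; lia.
Qed.

Let row_end : (coord x k - (k - k) = 0)%N.
Proof. by rewrite /coord insubF ?ltnn. Qed.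

Lemma is_shape_of_point : is_shape (shape_of_point x).
Proof. exact: is_shape_of_rows. Qed.

Lemma size_shape_of_point : (size (shape_of_point x) <= k)%N.
Proof.
rewrite leqNgt -row_len_gt0 ?is_shape_of_point //.
by rewrite /shape_of_point row_len_of_rows // row_end.
Qed.

Lemma shape_of_pointK : point (shape_of_point x) = x.
Proof.
have [_ /forallP pos] := andP ch.
apply/rowP=> i; rewrite mxE row_len_of_rows // subnK ?coord_ge // coordE.
by rewrite gtz0_abs ?pos.
Qed.

End Chamber.

Lemma point_inj la mu : is_shape la -> is_shape mu ->
  (size la <= k)%N -> (size mu <= k)%N -> point la = point mu -> la = mu.
Proof.
move=> sl sm lk mk e; apply: shape_ext => // i.
have [ik|ki] := ltnP i k; last by rewrite !nth_default // (leq_trans _ ki).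
by have := coord_point la ik; rewrite e coord_point //; lia.
Qed.

Lemma pointK la : is_shape la -> (size la <= k)%N -> shape_of_point (point la) = la.
Proof.
move=> sl lk; have ch := in_chamber_point sl.
by apply: point_inj; rewrite ?is_shape_of_point ?size_shape_of_point ?shape_of_pointK.
Qed.

Lemma point_incr la (i : 'I_k) : point (incr_nth la i) = point la + delta_mx 0 i.
Proof.
apply/rowP=> j; rewrite !mxE eqxx /= nth_incr_nth (inj_eq val_inj) eq_sym.
by rewrite -addnA addnC PoszD; case: (j == i).
Qed.

Lemma adds_box_point la mu : is_shape la -> is_shape mu ->
  (size la <= k)%N -> (size mu <= k)%N ->
  adds_box la mu = [exists i : 'I_k, point mu - point la == delta_mx 0 i].
Proof.
move=> sl sm lk mk; apply/adds_boxP/existsP => // -[].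
  move=> r e; have rk : (r < k)%N.
    move: mk; rewrite e size_incr_nth; case: ifP => // rl _; exact: leq_trans lk.
  by exists (Ordinal rk); rewrite e (point_incr la (Ordinal rk)) addrC addKr.
move=> i /eqP e; exists i; have {}e : point mu = point (incr_nth la i).
  by rewrite point_incr -e addrC subrK.
have rowE j : (j < k)%N -> row_len mu j = row_len (incr_nth la i) j.
  by move=> jk; have := coord_point mu jk; rewrite e coord_point //; lia.
(* Points see only the first [k] rows; there the enlarged [la] agrees with [mu] and inherits its
   monotonicity. *)
have si : is_shape (incr_nth la i).
  rewrite is_shape_incr //; case: posnP => //= i0.
  have := rowE i (ltn_ord i); have := rowE i.-1 (leq_ltn_trans (leq_pred i) (ltn_ord i)).
  have := row_len_mono sm (leq_pred i); rewrite !nth_incr_nth eqxx.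
  by case: eqP => /=; lia.
apply: point_inj e => //; rewrite size_incr_nth; case: ifP => //.
Qed.

Lemma is_step_point la mu : is_shape la -> is_shape mu ->
  (size la <= k)%N -> (size mu <= k)%N ->
  is_step (point mu - point la) = adds_box la mu || adds_box mu la.
Proof.
move=> sl sm lk mk; rewrite !adds_box_point // -[point la - _]opprB.
apply/existsP/orP => [[i /orP[e|e]]|[/existsP[i e]|/existsP[i e]]].
- by left; apply/existsP; exists i.
- by right; apply/existsP; exists i; rewrite (eqP e) opprK.
- by exists i; rewrite e.
- by exists i; rewrite -(eqP e) opprK eqxx orbT.
Qed.

Lemma wstartE : wstart k = point [::].
Proof. by apply/rowP=> i; rewrite !mxE nth_nil. Qed.

(** For [k = 0] and [m > 0] the shape [(m)] has too many rows, which matches the condition in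
    [is_wend]. *)
Lemma is_wendE m x : is_wend m x = (size (one_row m) <= k)%N && (x == point (one_row m)).
Proof.
rewrite /is_wend size_one_row; congr (_ && _); first by case: m; case: k => //.
congr (_ == _); apply/rowP=> i; rewrite !mxE.
case: (nat_of_ord i) => [|j] /=; first by rewrite subn0; case: m.
by case: m => [|m] //=; rewrite ?nth_nil.
Qed.

End Points.

(** * Bijection between tableaux and walks *)

Section Walks.
Variables n k m : nat.
Local Open Scope ring_scope.

Definition tableau_walk (t : n.+1.-tuple (seq nat)) : n.-tuple 'rV[int]_k :=
  [tuple of pairmap (fun x y => y - x) (wstart k) (map (point k) (behead t))].

Definition walk_tableau (w : n.-tuple 'rV[int]_k) : n.+1.-tuple (seq nat) :=
  [tuple of map (@shape_of_point k) (wstart k :: scanl +%R (wstart k) w)].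

Lemma all_pairmap_path (T S : Type) (p : pred S) (f : T -> T -> S) x s :
  all p (pairmap f x s) = path (fun y z => p (f y z)) x s.
Proof. by elim: s x => //= y s IH x; rewrite IH. Qed.

(** Both conversions produce related pairs, so a single lemma compares the validity of tableau and
    walk. *)
Definition visits (t : seq (seq nat)) (w : seq 'rV[int]_k) : Prop :=
  map (point k) t = wstart k :: scanl +%R (wstart k) w.

Let stepK : forall x : 'rV[int]_k, cancel (+%R x) (fun y => y - x).
Proof. by move=> x y; rewrite addrC addKr. Qed.

Let stepVK : forall x : 'rV[int]_k, cancel (fun y => y - x) (+%R x).
Proof. by move=> x y; rewrite addrC subrK. Qed.

Lemma is_oscillating_walkE (t : n.+1.-tuple (seq nat)) (w : n.-tuple 'rV[int]_k) :
  visits t w -> all is_shape t -> all (fun la => size la <= k)%N t ->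
  is_oscillating_walk m w = is_oscillating_tableau k m t.
Proof.
case: t => -[//|a t] tn /= [a0 ts] /andP[sa st] /andP[ka kt].
have {}a0 : a = [::].
  by apply: (@point_inj k) => //; rewrite a0 wstartE.
rewrite {a}a0 in tn sa ka *.
rewrite /is_oscillating_walk /is_oscillating_tableau !(tnth_nth [::]) /= -ts.
have -> : nth [::] ([::] :: t) n = last [::] t.
  by rewrite (last_nth [::]); move: tn => /eqP[<-].
have [lP kP] : is_shape (last [::] t) /\ (size (last [::] t) <= k)%N.
  case/lastP: t {ts tn} st kt => // t b.
  by rewrite last_rcons !all_rcons => /andP[-> _] /andP[-> _].
rewrite st kt /= wstartE last_map is_wendE in_chamber_point //=.
have -> : all (@in_chamber k) (map (point k) t).
  by rewrite all_map; apply: sub_all st => la; apply: in_chamber_point.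
(* The steps of [w] are recovered as differences of successive visited points. *)
rewrite -{1}[tval w](scanlK stepK (wstart k)) -ts all_pairmap_path wstartE path_map.
congr (_ && _).
  apply: (@eq_in_path _ [pred la | is_shape la & (size la <= k)%N]).
    by move=> la mu /andP[sl lk] /andP[sm mk]; apply: is_step_point.
  by rewrite /= all_predI st kt.
rewrite /=; apply/andP/eqP => [[mk /eqP e]|<-]; last by rewrite kP eqxx.
by apply: point_inj e => //; apply: is_shape_one_row.
Qed.

Lemma visits_tableau_walk (t : n.+1.-tuple (seq nat)) :
  nth [::] t 0 = [::] -> visits t (tableau_walk t).
Proof.
by case: t => -[//|a t] tn /= ->; rewrite /visits /= (pairmapK stepVK) wstartE.
Qed.

Lemma visits_walk_tableau (w : n.-tuple 'rV[int]_k) :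
  is_oscillating_walk m w -> visits (walk_tableau w) w.
Proof.
case/and3P=> _ /allP ch _; rewrite /visits.
rewrite -[tval _]/(map (@shape_of_point k) (wstart k :: scanl +%R (wstart k) w)).
by rewrite -map_comp -[RHS]map_id; apply/eq_in_map => x /ch /shape_of_pointK.
Qed.

Lemma walk_tableauP (w : n.-tuple 'rV[int]_k) :
  is_oscillating_walk m w -> is_oscillating_tableau k m (walk_tableau w).
Proof.
move=> ww; have /and3P[_ ch _] := ww.
rewrite -(is_oscillating_walkE (visits_walk_tableau ww)) // all_map;
  apply: sub_all ch => x; [exact: is_shape_of_point|exact: size_shape_of_point].
Qed.

Lemma tableau_walkP (t : n.+1.-tuple (seq nat)) :
  is_oscillating_tableau k m t -> is_oscillating_walk m (tableau_walk t).
Proof.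
move=> tt; have /and5P[sh _ sz + _] := tt; rewrite (tnth_nth [::]) => /eqP t0.
by rewrite (is_oscillating_walkE (visits_tableau_walk t0)).
Qed.

Lemma tableau_walkK (t : n.+1.-tuple (seq nat)) :
  is_oscillating_tableau k m t -> walk_tableau (tableau_walk t) = t.
Proof.
move=> tt; have /and5P[sh _ sz + _] := tt; rewrite (tnth_nth [::]) => /eqP t0.
apply: val_inj; rewrite /= -[_ :: map _ _]/(map _ (_ :: _)).
rewrite -(visits_tableau_walk t0) -map_comp -[RHS]map_id.
by apply/eq_in_map => la lt; rewrite /= pointK ?(allP sh) ?(allP sz).
Qed.

Lemma walk_tableauK (w : n.-tuple 'rV[int]_k) :
  is_oscillating_walk m w -> tableau_walk (walk_tableau w) = w.
Proof.
move/visits_walk_tableau => vs; apply: val_inj.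
by rewrite -[RHS](scanlK stepK (wstart k)); case: vs => _ <-.
Qed.

End Walks.

(** * Bijections between the three sets *)

Lemma sig_bijective (T U : eqType) (P : pred T) (Q : pred U)
    (f : T -> U) (g : U -> T) :
  {homo f : x / P x >-> Q x} -> {homo g : y / Q y >-> P y} ->
  {in P, cancel f g} -> {in Q, cancel g f} ->
  exists h : {x | P x} -> {y | Q y}, bijective h.
Proof.
move=> PQ QP fK gK.
exists (fun x => exist _ (f (sval x)) (PQ _ (svalP x))).
exists (fun y => exist _ (g (sval y)) (QP _ (svalP y))).
  by move=> [x Px]; apply: val_inj; apply: fK.
by move=> [y Qy]; apply: val_inj; apply: gK.
Qed.

Theorem theorem3 (n m k : nat) :
  (exists f : oscillating_tableau n k m -> oscillating_walk n k m,
     bijective f) /\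
  (exists g : oscillating_walk n k m -> nonnesting_diagram n k m,
     bijective g).
Proof.
split.
  apply: (sig_bijective (f := @tableau_walk n k) (g := @walk_tableau n k)).
  - exact: tableau_walkP.
  - exact: walk_tableauP.
  - exact: tableau_walkK.
  - exact: walk_tableauK.
(* Walks and diagrams correspond through tableaux. *)
apply: (sig_bijective (f := fun w => tableau_diagram (@walk_tableau n k w))
  (g := fun D => tableau_walk k (diagram_tableau D))).
- by move=> w /walk_tableauP/tableau_diagramP.
- by move=> D /diagram_tableauP/tableau_walkP.
- move=> w ww; have tt := walk_tableauP ww.
  by rewrite (tableau_diagramK tt) (walk_tableauK ww).
- move=> D DD; have tt := diagram_tableauP DD.
  by rewrite (tableau_walkK tt) (diagram_tableauK DD).
Qed.
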